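(* Consider a Bisect and Approximate (BA) algorithm run with input $a\in\mathbb{R}$, $k\in\{1,2,\dots\}$, $b>0$, $\beta>0$. Let $f\colon[0,1]^d\to\mathbb{R}$ be an arbitrary function with level set $\{f=a\}\neq\varnothing$. Assume that the local approximators $g_{C'}$ picked by the algorithm (at the step ''pick a local approximator $g_{C'}$'') are $(b,\beta)$-accurate approximations of $f$ (on $C'$). Fix any accuracy $\varepsilon>0$, let $i(\varepsilon) := \bigl\lceil \tfrac{1}{\beta}\log_2\bigl(\tfrac{2b}{\varepsilon}\bigr)\bigr\rceil$, and define \[ n(\varepsilon) := 4^d\, k \sum_{i=0}^{i(\varepsilon)-1} \lim_{\delta\to1^-} \mathcal{N}\Bigl(\bigl\{|f-a|\le 2\,b\,2^{-\beta i}\bigr\},\ \delta\,2^{-i}\Bigr), \] where the sum is $0$ if its upper limit is negative. Then, for all $n>n(\varepsilon)$, the output $S_n$ returned after the $n$-th query is an $\varepsilon$-approximation of $\{f=a\}$.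
   Context: $d\ge1$ is an integer. $\{f=a\}:=\{x\in[0,1]^d: f(x)=a\}$ and $\{|f-a|\le r\}:=\{x\in[0,1]^d:|f(x)-a|\le r\}$. A set $S\subseteq[0,1]^d$ is an $\varepsilon$-approximation of $\{f=a\}$ if $\{f=a\}\subseteq S\subseteq\{|f-a|\le\varepsilon\}$. Packing number: for $r>0$ and $E\subseteq[0,1]^d$, $\mathcal{N}(E,r):=\sup\{k\in\{1,2,\dots\}:\exists\,x_1,\dots,x_k\in E,\ \min_{i\neq j}\|x_i-x_j\|_\infty>r\}$ if $E\ne\varnothing$, and $0$ otherwise. Accurate approximation: for $b,\beta>0$ and $C\subseteq[0,1]^d$, a function $g\colon C\to\mathbb{R}$ is a $(b,\beta)$-accurate approximation of $f$ on $C$ if $\sup_{x\in C}|g(x)-f(x)|\le b\,\bigl(\sup_{x,y\in C}\|x-y\|_\infty\bigr)^\beta$. Bisection: for a family $\mathcal{C}$ of $m$ hypercubes included in $[0,1]^d$, $\mathrm{bisect}(\mathcal{C})$ is the family of the $2^d m$ hypercubes obtained by subdividing each $C=[a_1,b_1]\times\cdots\times[a_d,b_d]\in\mathcal{C}$ into the $2^d$ hypercubes $I_1\times\cdots\times I_d$ with each $I_j$ equal to $[a_j,(a_j+b_j)/2]$ or $[(a_j+b_j)/2,b_j]$. BA algorithm with input $(a,k,b,\beta)$: initialize $D=[0,1]^d$, $\mathcal{C}_0=\{D\}$, $g_D\equiv a$, $n=0$. For iterations $i=1,2,\dots$: set $S(i):=\bigcup_{C\in\mathcal{C}_{i-1}}\{x\in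 C:|g_C(x)-a|\le b\,2^{-\beta(i-1)}\}$ and $\mathcal{C}_i':=\mathrm{bisect}(\mathcal{C}_{i-1})$. For each hypercube $C'\in\mathcal{C}_i'$: repeat $k$ times (increase $n$ by $1$, pick a query point $x_n\in C'$, observe $f(x_n)$, output $S_n:=S(i)$); then pick a local approximator $g_{C'}\colon C'\to\mathbb{R}$. After all $C'\in\mathcal{C}_i'$ are processed, set $\mathcal{C}_i:=\{C'\in\mathcal{C}_i':\exists x\in C',\ |g_{C'}(x)-a|\le b\,2^{-\beta i}\}$. Different rules for picking query points and local approximators give different BA algorithms.
   Formalization: In the case i(ε) ≤ 0 only, the initial approximator g_D ≡ a is also assumed to be a (b,β)-accurate approximation of f on [0,1]^d; without this the claim fails there, since n(ε) = 0 and S_1 = [0,1]^d whatever f is. *)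

(* Defs.v *)
From mathcomp Require Import all_boot all_order all_algebra.
From mathcomp Require Import all_classical all_reals all_analysis.

Set Implicit Arguments.
Unset Strict Implicit.
Unset Printing Implicit Defensive.

Import Order.TTheory GRing.Theory Num.Theory.
Import numFieldNormedType.Exports.
Local Open Scope classical_set_scope.
Local Open Scope ring_scope.

(* Points are row vectors, whose library norm `|x| is the sup-norm.  Functions
   on a subset of R^d are represented by total functions on R^d, of which only
   the values on that subset are ever used. *)

(* The box (l, u) stands for [l_1, u_1] x ... x [l_d, u_d]. *)
Definition box (R : realType) (d : nat) : Type := ('rV[R]_d * 'rV[R]_d)%type.

Definition box_set (R : realType) (d : nat) (C : box R d) : set 'rV[R]_d :=
  [set x | forall j, C.1 0 j <= x 0 j <= C.2 0 j].

Definition unit_box (R : realType) (d : nat) : box R d :=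
  (const_mx 0, const_mx 1).

Definition level_set (R : realType) (d : nat) (f : 'rV[R]_d -> R) (a : R) :
    set 'rV[R]_d :=
  [set x | box_set (unit_box R d) x /\ f x = a].

Definition inflated_level_set (R : realType) (d : nat) (f : 'rV[R]_d -> R)
    (a r : R) : set 'rV[R]_d :=
  [set x | box_set (unit_box R d) x /\ `|f x - a| <= r].

Definition eps_approximation (R : realType) (d : nat) (f : 'rV[R]_d -> R)
    (a eps : R) (S : set 'rV[R]_d) : Prop :=
  level_set f a `<=` S /\ S `<=` inflated_level_set f a eps.

Definition packing_number (R : realType) (d : nat) (E : set 'rV[R]_d) (r : R) :
    \bar R :=
  if `[< E !=set0 >] then
    ereal_sup [set (m%:R)%:E | m in [set m : nat | (0 < m)%N /\
      exists x : 'I_m -> 'rV[R]_d, (forall i, E (x i)) /\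
        (forall i j, i != j -> r < `|x i - x j|)]]
  else 0%E.

(* A real supremum: only meant for nonempty bounded sets. *)
Definition diameter (R : realType) (d : nat) (C : set 'rV[R]_d) : R :=
  sup [set `|p.1 - p.2| | p in C `*` C].

(* The left-hand supremum is extended, since f is not assumed bounded. *)
Definition accurate (R : realType) (d : nat) (b beta : R)
    (f : 'rV[R]_d -> R) (C : set 'rV[R]_d) (g : 'rV[R]_d -> R) : Prop :=
  (ereal_sup [set `|g x - f x|%:E | x in C]
     <= (b * (diameter C) `^ beta)%:E)%E.

Definition sub_box (R : realType) (d : nat) (C : box R d)
    (s : {ffun 'I_d -> bool}) : box R d :=
  (\row_j (if s j then (C.1 0 j + C.2 0 j) / 2 else C.1 0 j),
   \row_j (if s j then C.2 0 j else (C.1 0 j + C.2 0 j) / 2)).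

Definition bisect (R : realType) (d : nat) (Cs : seq (box R d)) :
    seq (box R d) :=
  [seq sub_box C s | C <- Cs, s <- enum {ffun 'I_d -> bool}].

(* One entry (x_n, f x_n, S_n) for each query made so far. *)
Definition ba_log (R : realType) (d : nat) : Type :=
  seq ('rV[R]_d * R * set 'rV[R]_d).

(* The rules left open by the Bisect and Approximate scheme.  They may depend
   on everything observed so far; the order in which the boxes of an iteration
   are processed is one of them. *)
Record ba_algorithm (R : realType) (d : nat) : Type := BaAlgorithm {
  ba_order : ba_log R d -> seq (box R d) -> seq (box R d);
  ba_query : ba_log R d -> box R d -> 'rV[R]_d;
  ba_approx : ba_log R d -> box R d -> 'rV[R]_d -> R;
  ba_orderP : forall h Cs, perm_eq (ba_order h Cs) Cs;
  ba_queryP : forall h C, box_set C !=set0 -> box_set C (ba_query h C)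
}.

(* A family of boxes C, each with its local approximator g_C. *)
Definition ba_family (R : realType) (d : nat) : Type :=
  seq (box R d * ('rV[R]_d -> R)).

(* After iteration i: ba_picked is C'_i with the approximators picked during
   the iteration, and ba_kept is C_i. *)
Record ba_state (R : realType) (d : nat) : Type := BaState {
  ba_history : ba_log R d;
  ba_picked : ba_family R d;
  ba_kept : ba_family R d
}.

Definition ba_init (R : realType) (d : nat) (a : R) : ba_state R d :=
  BaState [::] [::] [:: (unit_box R d, cst a)].

Definition ba_threshold (R : realType) (b beta : R) (i : nat) : R :=
  b * 2 `^ (- (beta * i%:R)).

(* With the family C_{i-1} and the threshold b 2^(-beta (i-1)), this is S(i). *)
Definition ba_region (R : realType) (d : nat) (a t : R) (F : ba_family R d) :
    set 'rV[R]_d :=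
  [set x | exists2 Cg, Cg \in F & box_set Cg.1 x /\ `|Cg.2 x - a| <= t].

Definition ba_do_query (R : realType) (d : nat) (alg : ba_algorithm R d)
    (f : 'rV[R]_d -> R) (S : set 'rV[R]_d) (C : box R d) (h : ba_log R d) :
    ba_log R d :=
  let x := ba_query alg h C in rcons h (x, f x, S).

Definition ba_process (R : realType) (d : nat) (alg : ba_algorithm R d)
    (f : 'rV[R]_d -> R) (k : nat) (S : set 'rV[R]_d)
    (hF : ba_log R d * ba_family R d) (C : box R d) :
    ba_log R d * ba_family R d :=
  let h := iter k (ba_do_query alg f S C) hF.1 in
  (h, rcons hF.2 (C, ba_approx alg h C)).

(* Iteration i.+1. *)
Definition ba_iteration (R : realType) (d : nat) (alg : ba_algorithm R d)
    (f : 'rV[R]_d -> R) (a : R) (k : nat) (b beta : R) (i : nat)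
    (st : ba_state R d) : ba_state R d :=
  let S := ba_region a (ba_threshold b beta i) (ba_kept st) in
  let Cs := ba_order alg (ba_history st)
              (bisect [seq Cg.1 | Cg <- ba_kept st]) in
  let hF := foldl (ba_process alg f k S) (ba_history st, [::]) Cs in
  BaState hF.1 hF.2
    [seq Cg <- hF.2 | `[< exists2 x, box_set Cg.1 x &
                            `|Cg.2 x - a| <= ba_threshold b beta i.+1 >]].

Fixpoint ba_run (R : realType) (d : nat) (alg : ba_algorithm R d)
    (f : 'rV[R]_d -> R) (a : R) (k : nat) (b beta : R) (i : nat) :
    ba_state R d :=
  if i is j.+1
  then ba_iteration alg f a k b beta j (ba_run alg f a k b beta j)
  else ba_init d a.

(* S is the output S_n returned after the n-th query, n >= 1 (the log is only
   ever extended, so there is at most one such S). *)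
Definition ba_output (R : realType) (d : nat) (alg : ba_algorithm R d)
    (f : 'rV[R]_d -> R) (a : R) (k : nat) (b beta : R) (n : nat)
    (S : set 'rV[R]_d) : Prop :=
  (0 < n)%N /\ exists i x y,
    onth (ba_history (ba_run alg f a k b beta i)) n.-1 = Some (x, y, S).

Definition i_eps (R : realType) (b beta eps : R) : int :=
  Num.ceil (beta^-1 * (ln (2 * b / eps) / ln 2)).

(* The limit of the packing number of {|f - a| <= 2 b 2^(-beta i)} at scale
   delta 2^(-i) as delta tends to 1 from below; it exists since the packing
   number is nonincreasing in the scale. *)
Definition packing_limit (R : realType) (d : nat) (f : 'rV[R]_d -> R) (a : R)
    (b beta : R) (i : nat) : \bar R :=
  lim (packing_number
         (inflated_level_set f a (2 * b * 2 `^ (- (beta * i%:R))))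
         (delta * 2 ^- i) @[delta --> (1:R)^'-]).

Definition n_eps (R : realType) (d : nat) (f : 'rV[R]_d -> R) (a : R) (k : nat)
    (b beta eps : R) : \bar R :=
  (((4 ^ d * k)%N%:R)%:E *
   \sum_(0 <= i < `|Num.max 0%R (i_eps b beta eps)|%N)
     packing_limit f a b beta i)%E.

(* Main.v *)
Require Import Defs.
From mathcomp Require Import all_boot all_order all_algebra.
From mathcomp Require Import all_classical all_reals all_analysis.
From mathcomp Require Import zify ring lra.
Import Order.TTheory GRing.Theory Num.Theory.
Import numFieldNormedType.Exports.
Local Open Scope classical_set_scope.
Local Open Scope ring_scope.

(* Every box of C_i is a dyadic box of side 2^-i.  By accuracy, a point of the
   level set stays in a kept box at every iteration, while the boxes of C_i all
   contain a point where |f - a| <= 2 b 2^(-beta i).  Splitting C_i into its 2^d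
   parity classes makes boxes of a same class 2^-i apart, so that C_i has at
   most 2^d times as many boxes as the packing number at any scale < 2^-i.
   Hence the first i(eps) iterations use at most n(eps) queries, and any later
   output is within 2 b 2^(-beta i(eps)) <= eps of the level. *)

(** * The sup-norm and dyadic boxes *)

Lemma coord_le_norm {R : realType} {d : nat} (x : 'rV[R]_d) j :
  `|x 0 j| <= `|x|.
Proof.
rewrite [leRHS]/Num.Def.normr/= mx_normrE; apply/bigmax_geP; right => /=.
by exists (0, j).
Qed.

Lemma norm_le_coord {R : realType} {d : nat} (x : 'rV[R]_d) (r : R) :
  0 <= r -> (forall j, `|x 0 j| <= r) -> `|x| <= r.
Proof.
move=> r0 xr; rewrite [leLHS]/Num.Def.normr/= mx_normrE.
by apply: bigmax_le => // -[i j] _ /=; rewrite ord1.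
Qed.

(** Natural indices turn distinctness and parity of boxes into arithmetic; [z j < 2 ^ i] is imposed
    separately where the box must lie in the unit cube. *)
Definition dyadic_box {R : realType} {d : nat} (i : nat)
    (z : {ffun 'I_d -> nat}) : box R d :=
  (\row_j ((z j)%:R * 2 ^- i), \row_j ((z j).+1%:R * 2 ^- i)).

Lemma dyadic_boxP {R : realType} {d : nat} i (z : {ffun 'I_d -> nat})
    (x : 'rV[R]_d) :
  box_set (dyadic_box i z) x <->
  forall j, (z j)%:R * 2 ^- i <= x 0 j <= (z j).+1%:R * 2 ^- i.
Proof. by split=> + j => /(_ j); rewrite !mxE. Qed.

Lemma exp2V_gt0 {R : realType} i : 0 < 2 ^- i :> R.
Proof. by rewrite invr_gt0 exprn_gt0. Qed.

Lemma exp2VS {R : realType} i : 2 ^- i = 2 * 2 ^- i.+1 :> R.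
Proof. by rewrite exprS invfM mulVKf. Qed.

Lemma dyadic_box_inj {R : realType} {d : nat} i :
  injective (@dyadic_box R d i).
Proof.
move=> z z' [/rowP zz' _]; apply/ffunP => j; have := zz' j; rewrite !mxE.
by move/(mulIf (lt0r_neq0 (exp2V_gt0 i)))/eqP; rewrite eqr_nat => /eqP.
Qed.

Lemma dyadic_box_corner {R : realType} {d : nat} i (z : {ffun 'I_d -> nat}) :
  box_set (dyadic_box i z) (dyadic_box i z : box R d).1.
Proof.
by move=> j; rewrite lexx !mxE ler_wpM2r ?(ltW (exp2V_gt0 _)) ?ler_nat.
Qed.

Lemma sub_dyadic_box {R : realType} {d : nat} i (z : {ffun 'I_d -> nat})
    (s : {ffun 'I_d -> bool}) :
  sub_box (dyadic_box i z : box R d) s =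
  dyadic_box i.+1 [ffun j => (s j + (z j).*2)%N].
Proof.
congr pair; apply/rowP => j; rewrite !mxE ffunE exp2VS; case: (s j);
  rewrite ?(add0n, add1n) -?natr1 -addnn natrD; field; exact: expf_neq0.
Qed.

Lemma sub_box_cover {R : realType} {d : nat} {C : box R d} {x : 'rV[R]_d} :
  box_set C x -> exists s, box_set (sub_box C s) x.
Proof.
move=> Cx; exists [ffun j => (C.1 0 j + C.2 0 j) / 2 <= x 0 j] => j.
have /andP[a1 a2] := Cx j; rewrite !mxE ffunE.
by case: (leP (_ / 2) (x 0 j)) => [->|/ltW ->]; rewrite ?a1 ?a2.
Qed.

Lemma unit_box_dyadic {R : realType} {d : nat} :
  unit_box R d = dyadic_box 0 [ffun=> 0%N].
Proof.
by congr pair; apply/rowP => j; rewrite !mxE ffunE ?mul0r// expr0 invr1 mulr1.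
Qed.

Lemma dyadic_box_sub_unit {R : realType} {d : nat} i (z : {ffun 'I_d -> nat}) :
  (forall j, z j < 2 ^ i)%N ->
  box_set (dyadic_box i z) `<=` box_set (unit_box R d).
Proof.
move=> zi x zx j; have := zx j; rewrite !mxE => /andP[zx1 zx2].
apply/andP; split.
  by apply: le_trans zx1; rewrite mulr_ge0// ltW// exp2V_gt0.
by apply: (le_trans zx2); rewrite ler_pdivrMr ?exprn_gt0// mul1r -natrX ler_nat.
Qed.

Lemma diameter_dyadic_box {R : realType} {d : nat} i (z : {ffun 'I_d -> nat}) :
  0 <= diameter (box_set (dyadic_box i z : box R d)) <= 2 ^- i.
Proof.
rewrite /diameter; set E := image _ _.
(* The element 0 gives the lower bound and also the nonemptiness required to bound [sup] from
   above. *)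
have E0 : E 0.
  exists ((dyadic_box i z : box R d).1, (dyadic_box i z : box R d).1) => /=.
    by split; exact: dyadic_box_corner.
  by rewrite subrr normr0.
have Eub : ubound E (2 ^- i).
  move=> _ [[x y] /= [/= /dyadic_boxP zx /dyadic_boxP zy] <-].
  apply: norm_le_coord => [|j]; first exact/ltW/exp2V_gt0.
  have := zx j; have := zy j; rewrite !mxE -[(z j).+1]addn1 natrD => ? ?.
  by rewrite ler_norml; lra.
apply/andP; split; last by apply: ge_sup => //; exists 0.
by apply: ub_le_sup E0; exists (2 ^- i).
Qed.

(** The side 2^-i bounds the diameter, so accuracy yields exactly the threshold that the algorithm
    uses at level i. *)
Lemma accurate_dyadic_box {R : realType} {d : nat} {b beta : R} {f g} {i}
    {z : {ffun 'I_d -> nat}} {x : 'rV[R]_d} :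
  0 < b -> 0 < beta ->
  accurate b beta f (box_set (dyadic_box i z)) g ->
  box_set (dyadic_box i z) x -> `|g x - f x| <= ba_threshold b beta i.
Proof.
move=> b0 beta0 acc zx.
have /andP[dge dle] := @diameter_dyadic_box R d i z.
rewrite -lee_fin; apply: le_trans (le_trans acc _).
  by apply: ereal_sup_ubound; exists x.
rewrite lee_fin /ba_threshold ler_wpM2l ?(ltW b0)//.
apply: le_trans (ge0_ler_powR (ltW beta0) _ _ dle) _;
  rewrite ?nnegrE// ?(ltW (exp2V_gt0 _))//.
by rewrite -powR_invn// -powRrM mulNr mulrC.
Qed.

(* Two boxes of the same parity class that differ in a coordinate are at least
   two steps apart there, so their points are at least one step apart. *)
Lemma dyadic_box_separated {R : realType} {d i : nat}
    {z z' : {ffun 'I_d -> nat}} {x y : 'rV[R]_d} :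
  z != z' -> (forall j, odd (z j) = odd (z' j)) ->
  box_set (dyadic_box i z) x -> box_set (dyadic_box i z') y ->
  2 ^- i <= `|x - y|.
Proof.
wlog [j zj] : z z' x y / exists j, (z j < z' j)%N.
  move=> W zz' par zx zy; have [j zj] : exists j, z j != z' j.
    apply/existsP; apply: contraNT zz'; rewrite negb_exists => /forallP H.
    by apply/eqP/ffunP => j; apply/eqP; rewrite -[_ == _]negbK.
  have [lt|gt|eq] := ltngtP (z j) (z' j).
  - by apply: W zx zy => //; exists j.
  - rewrite distrC; apply: W zy zx => //; [by exists j|by rewrite eq_sym].
  - by rewrite eq eqxx in zj.
move=> _ /(_ j) par /dyadic_boxP/(_ j)/andP[_ zx] /dyadic_boxP/(_ j)/andP[zy _].
apply: le_trans (coord_le_norm _ j); rewrite !mxE.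
have z2 : ((z j).+1%:R + 1) * 2 ^- i <= (z' j)%:R * 2 ^- i :> R.
  by rewrite ler_wpM2r ?(ltW (exp2V_gt0 _))// natr1 ler_nat; lia.
rewrite ler_normr; apply/orP; right; lra.
Qed.

(** * Packing numbers and their left limits *)

Lemma packing_number_ge0 {R : realType} {d : nat} (E : set 'rV[R]_d) r :
  (0 <= packing_number E r)%E.
Proof.
rewrite /packing_number; case: asboolP => // -[x Ex].
apply: le_ereal_sup_tmp; exists 1%:E => //=; exists 1%N => //; split=> //.
by exists (fun=> x); split=> // i j; rewrite !ord1 eqxx.
Qed.

Lemma packing_number_nincr {R : realType} {d : nat} (E : set 'rV[R]_d) :
  {homo packing_number E : r s / r <= s >-> (s <= r)%E}.
Proof.
move=> r s rs; rewrite /packing_number; case: asboolP => // _.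
apply: le_ereal_sup => _ [m [m0 [x [Ex xd]]] <-].
exists m => //; split=> //; exists x; split=> // i j ij.
exact: le_lt_trans rs (xd i j ij).
Qed.

(** The labels [zs] enumerate a packing of E. The supremum starts at one point, so an empty list is
    settled by nonnegativity instead. *)
Lemma packing_number_ge {R : realType} {d : nat} {T : eqType}
    (P : T -> 'rV[R]_d) (zs : seq T) (E : set 'rV[R]_d) r :
  uniq zs -> (forall z, z \in zs -> E (P z)) ->
  (forall z z', z \in zs -> z' \in zs -> z != z' -> r < `|P z - P z'|) ->
  ((size zs)%:R%:E <= packing_number E r)%E.
Proof.
case: zs => [|z0 zs] u ; first by rewrite packing_number_ge0.
set s := z0 :: zs => Es rs.
have sE (i : 'I_(size s)) : nth z0 s i \in s by exact: mem_nth.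
rewrite /packing_number; case: asboolP => [_|[]]; last first.
  by exists (P z0); apply: Es; rewrite mem_head.
apply: ereal_sup_ubound; exists (size s) => //; split=> //.
exists (fun i => P (nth z0 s i)); split=> [i|i j ij]; first exact: Es.
by apply: rs => //; rewrite nth_uniq.
Qed.

(** Each of the 2^d parity classes yields one packing. Points of a class may be exactly 2^-i apart
    while a packing asks for a strict inequality, hence [delta] below 1. *)
Lemma size_le_packing_number {R : realType} {d : nat} i (delta : R)
    (zs : seq {ffun 'I_d -> nat}) (E : set 'rV[R]_d) :
  delta < 1 -> uniq zs ->
  (forall z, z \in zs -> exists2 x, E x & box_set (dyadic_box i z) x) ->
  ((size zs)%:R%:E <= (2 ^ d)%:R%:E * packing_number E (delta * 2 ^- i))%E.
Proof.
move=> delta1 u zsE.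
pose par (z : {ffun 'I_d -> nat}) := [ffun j => odd (z j)].
have -> : size zs = (\sum_(p : {ffun 'I_d -> bool})
    count (fun z => par z == p) zs)%N.
  rewrite -count_predT -sum1_count (partition_big par predT)//=.
  by apply: eq_bigr => p _; rewrite sum1_count.
rewrite natr_sum -sumEFin.
have -> : ((2 ^ d)%:R%:E * packing_number E (delta * 2 ^- i) =
    \sum_(p : {ffun 'I_d -> bool}) packing_number E (delta * 2 ^- i))%E.
  by rewrite mule_natl sumr_const card_ffun card_bool card_ord.
apply: lee_sum => p _; rewrite -size_filter.
(* One point of E is chosen in each box; 0 is a dummy value outside [zs]. *)
have /choice[P HP] z : exists x, z \in zs ->
    E x /\ box_set (dyadic_box i z) x.
  case: (boolP (z \in zs)) => [/zsE[x ? ?]|]; first by exists x.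
  by exists 0.
apply: (packing_number_ge P) => [|z|z z'].
- exact: filter_uniq.
- by rewrite mem_filter => /andP[_ /HP[]].
rewrite !mem_filter => /andP[/eqP zp /HP[_ Pz]] /andP[/eqP zp' /HP[_ Pz']] zz'.
apply: lt_le_trans (dyadic_box_separated zz' _ Pz Pz').
  by rewrite gtr_pMl ?exp2V_gt0.
by move=> j; have /ffunP/(_ j) := etrans zp (esym zp'); rewrite !ffunE.
Qed.

(** Monotone functions have one-sided limits in the extended reals. Reflecting [delta] to [- delta]
    turns this left limit into the right limit of a nondecreasing function. *)
Lemma packing_number_is_cvg {R : realType} {d : nat} (E : set 'rV[R]_d)
    (c : R) : 0 <= c ->
  cvg (packing_number E (delta * c) @[delta --> (1 : R)^'-]).
Proof.
move=> c0.
pose g (delta : R) := packing_number E (- delta * c).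
have : cvg (g delta @[delta --> (- 1 : R)^'+]).
  apply: nondecreasing_at_right_is_cvge; apply: nearW => x r s _ _ rs.
  by apply: packing_number_nincr; rewrite ler_wpM2r ?lerN2.
move=> /cvg_ex[l gl]; apply/cvg_ex; exists l.
apply/cvg_at_leftNP; exact: gl.
Qed.

Lemma size_le_packing_limit {R : realType} {d : nat} f (a b beta : R) i
    (zs : seq {ffun 'I_d -> nat}) :
  uniq zs ->
  (forall z, z \in zs -> exists2 x,
     inflated_level_set f a (2 * b * 2 `^ (- (beta * i%:R))) x &
     box_set (dyadic_box i z) x) ->
  ((size zs)%:R%:E <= (2 ^ d)%:R%:E * packing_limit f a b beta i)%E.
Proof.
move=> u zsE; have p0 : (0 < (2 ^ d)%:R :> R) by rewrite ltr0n expn_gt0.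
(* Once 2^d is moved to the left, a constant is compared with a limit, so the bound at each [delta]
   below 1 suffices. *)
rewrite -lee_pdivrMl//; apply: lime_ge.
  exact/packing_number_is_cvg/ltW/exp2V_gt0.
near=> delta; rewrite lee_pdivrMl//; apply: size_le_packing_number => //.
Unshelve. all: by end_near. Qed.

Lemma packing_limit_ge0 {R : realType} {d : nat} (f : 'rV[R]_d -> R)
    a b beta i :
  (0 <= packing_limit f a b beta i)%E.
Proof.
apply: lime_ge; first exact/packing_number_is_cvg/ltW/exp2V_gt0.
by apply: nearW => delta; exact: packing_number_ge0.
Qed.

(** * The query log and bisected families *)

Lemma ba_do_queries {R : realType} {d : nat} (alg : ba_algorithm R d) f S C k
    (h : ba_log R d) :
  exists2 l, iter k (ba_do_query alg f S C) h = h ++ l &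
    size l = k /\ forall e, e \in l -> e.2 = S.
Proof.
elim: k => [|k [l hl [sl lS]]]; first by exists [::]; rewrite ?cats0.
exists (rcons l (ba_query alg (h ++ l) C, f (ba_query alg (h ++ l) C), S)).
  by rewrite iterS hl; exact: rcons_cat.
split=> [|e]; first by rewrite size_rcons sl.
by rewrite mem_rcons inE => /orP[/eqP ->|/lS].
Qed.

(** The accumulator [hF] is arbitrary so that the induction on [Cs] goes through. *)
Lemma ba_process_all {R : realType} {d : nat} (alg : ba_algorithm R d) f k S
    (Cs : seq (box R d)) (hF : ba_log R d * ba_family R d) :
  let hF' := foldl (ba_process alg f k S) hF Cs in
  [seq Cg.1 | Cg <- hF'.2] = [seq Cg.1 | Cg <- hF.2] ++ Cs /\
  exists2 l, hF'.1 = hF.1 ++ l &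
    size l = (k * size Cs)%N /\ forall e, e \in l -> e.2 = S.
Proof.
elim: Cs hF => [|C Cs IH] [h F] /=.
  by rewrite cats0; split=> //; exists [::]; rewrite ?cats0 ?muln0.
have [l1 hl1 [sl1 l1S]] := ba_do_queries alg f S C k h.
have -> : ba_process alg f k S (h, F) C =
    (h ++ l1, rcons F (C, ba_approx alg (h ++ l1) C)).
  by rewrite /ba_process/= hl1.
have [-> [l2 -> [sl2 l2S]]] :=
  IH (h ++ l1, rcons F (C, ba_approx alg (h ++ l1) C)).
rewrite map_rcons cat_rcons; split=> //; exists (l1 ++ l2).
  by rewrite catA.
split=> [|e]; first by rewrite size_cat sl1 sl2 mulnS.
by rewrite mem_cat => /orP[/l1S|/l2S].
Qed.

Lemma size_bisect {R : realType} {d : nat} (Cs : seq (box R d)) :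
  size (bisect Cs) = (2 ^ d * size Cs)%N.
Proof. by rewrite size_allpairs -cardE card_ffun card_bool card_ord mulnC. Qed.

(** A child has index 2z + s: its parities recover s and its halves recover z, so no child arises
    twice. *)
Lemma bisect_dyadic {R : realType} {d i : nat} {zs : seq {ffun 'I_d -> nat}} :
  uniq zs -> (forall z, z \in zs -> forall j, (z j < 2 ^ i)%N) ->
  exists zs' : seq {ffun 'I_d -> nat},
  [/\ bisect [seq dyadic_box i z : box R d | z <- zs] =
        [seq dyadic_box i.+1 z | z <- zs'],
      uniq zs' & forall z, z \in zs' -> forall j, (z j < 2 ^ i.+1)%N].
Proof.
move=> uzs zsi.
pose child (z : {ffun 'I_d -> nat}) (s : {ffun 'I_d -> bool}) :=
  [ffun j => (s j + (z j).*2)%N].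
exists [seq child z s | z <- zs, s <- enum {ffun 'I_d -> bool}]; split.
- rewrite /bisect allpairs_mapl map_allpairs.
  by apply: eq_allpairs => z s; exact: sub_dyadic_box.
- apply: allpairs_uniq => //; first exact: enum_uniq.
  move=> [z s] [z' s'] _ _ /= /ffunP zs'.
  have E j : s j = s' j /\ z j = z' j.
    by have := zs' j; rewrite !ffunE; case: (s j); case: (s' j) => /=; lia.
  by congr pair; apply/ffunP => j; have [] := E j.
- move=> _ /allpairsP[[z s] /= [/zsi zi _ ->]] j.
  have := zi j; rewrite ffunE expnS.
  by case: (s j) => /=; lia.
Qed.

(** Used to write the kept boxes, known only as a subset of the bisected ones, as the image of a
    duplicate-free list of indices. *)
Lemma uniq_sub_map {S T : eqType} {f : S -> T} {s : seq T} {t : seq S} :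
  uniq s -> {subset s <= [seq f x | x <- t]} ->
  exists t', [/\ s = [seq f x | x <- t'], uniq t' & {subset t' <= t}].
Proof.
move=> us st; suff [t' st' t't] : exists2 t', s = [seq f x | x <- t'] &
    {subset t' <= t}.
  by exists t'; split=> //; apply: (@map_uniq _ _ f); rewrite -st'.
elim: s st {us} => [|y s IH] st; first by exists [::].
have [|t' -> t't] := IH; first by move=> z zs; apply: st; rewrite inE zs orbT.
have /mapP[x xt ->] := st y (mem_head _ _).
by exists (x :: t') => // z; rewrite inE => /orP[/eqP ->|/t't].
Qed.

(** * Invariants of the run *)

Section Run.
Context {R : realType} {d : nat} (alg : ba_algorithm R d).
Context (f : 'rV[R]_d -> R) (a : R) (k : nat) (b beta : R).
Let run := ba_run alg f a k b beta.

(** In the numbering of the algorithm this is S(i+1), output at every query of iteration i+1. *)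
Definition ba_output_set i : set 'rV[R]_d :=
  ba_region a (ba_threshold b beta i) (ba_kept (run i)).

(** Only a permutation, as the algorithm chooses the order in which boxes are processed. *)
Lemma ba_picked_boxes i : perm_eq [seq Cg.1 | Cg <- ba_picked (run i.+1)]
  (bisect [seq Cg.1 | Cg <- ba_kept (run i)]).
Proof.
have [pE _] := ba_process_all alg f k (ba_output_set i)
  (ba_order alg (ba_history (run i))
     (bisect [seq Cg.1 | Cg <- ba_kept (run i)]))
  (ba_history (run i), [::]).
by rewrite [X in perm_eq X _]pE; exact: ba_orderP.
Qed.

Lemma ba_kept_picked i : ba_kept (run i.+1) =
  [seq Cg <- ba_picked (run i.+1) | `[< exists2 x, box_set Cg.1 x &
     `|Cg.2 x - a| <= ba_threshold b beta i.+1 >]].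
Proof. by []. Qed.

Lemma ba_history_step i : exists2 l,
  ba_history (run i.+1) = ba_history (run i) ++ l &
  size l = (k * (2 ^ d * size (ba_kept (run i))))%N /\
  forall e, e \in l -> e.2 = ba_output_set i.
Proof.
have [_ [l hl [sl lS]]] := ba_process_all alg f k (ba_output_set i)
  (ba_order alg (ba_history (run i))
     (bisect [seq Cg.1 | Cg <- ba_kept (run i)]))
  (ba_history (run i), [::]).
exists l => //; split=> //.
by rewrite sl (perm_size (ba_orderP _ _ _)) size_bisect size_map.
Qed.

Lemma size_ba_history i : size (ba_history (run i)) =
  (\sum_(0 <= j < i) k * (2 ^ d * size (ba_kept (run j))))%N.
Proof.
elim: i => [|i IH]; first by rewrite big_geq.
have [l -> [sl _]] := ba_history_step i.
by rewrite size_cat IH sl big_nat_recr.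
Qed.

(** The bound on [n] is what later forces [j] to be large, since the log only grows. *)
Lemma ba_history_entry i n e :
  onth (ba_history (run i)) n = Some e ->
  exists2 j, (n < size (ba_history (run j.+1)))%N & e.2 = ba_output_set j.
Proof.
elim: i => [|i IH]; first by rewrite /= onth0n.
have [l hl [sl lS]] := ba_history_step i.
rewrite hl onth_cat; case: ltnP => [_ /IH //|ni nl]; exists i.
  rewrite hl size_cat -ltn_subLR// -onthTE; by rewrite nl.
by apply/lS/onthP; exists (n - size (ba_history (run i)))%N.
Qed.

(** Distinct indices allow the comparison with packing numbers; their bound keeps the boxes inside
    the unit cube. *)
Lemma ba_kept_dyadic i : exists zs : seq {ffun 'I_d -> nat},
  [/\ [seq Cg.1 | Cg <- ba_kept (run i)] = [seq dyadic_box i z | z <- zs],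
      uniq zs & forall z, z \in zs -> forall j, (z j < 2 ^ i)%N].
Proof.
elim: i => [|i [zs [kzs uzs zsi]]].
  exists [:: [ffun=> 0%N]]; split=> //=; first by rewrite unit_box_dyadic.
  by move=> z; rewrite inE => /eqP -> j; rewrite ffunE.
have [zs' [bzs' uzs' zsi']] := bisect_dyadic (R := R) uzs zsi.
have pb := ba_picked_boxes i; rewrite kzs bzs' in pb.
have upb : uniq [seq Cg.1 | Cg <- ba_picked (run i.+1)].
  by rewrite (perm_uniq pb) map_inj_uniq//; exact: dyadic_box_inj.
have sub : subseq [seq Cg.1 | Cg <- ba_kept (run i.+1)]
    [seq Cg.1 | Cg <- ba_picked (run i.+1)].
  by rewrite ba_kept_picked; apply: map_subseq; exact: filter_subseq.
have kz : {subset [seq Cg.1 | Cg <- ba_kept (run i.+1)] <=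
    [seq dyadic_box i.+1 z | z <- zs']}.
  by move=> C /(mem_subseq sub); rewrite (perm_mem pb).
have [zs'' [-> uzs'' zss]] := uniq_sub_map (subseq_uniq sub upb) kz.
by exists zs''; split=> // z /zss; exact: zsi'.
Qed.

Hypotheses (hb : 0 < b) (hbeta : 0 < beta).
Hypothesis (haccurate : forall i Cg, Cg \in ba_picked (run i) ->
  accurate b beta f (box_set Cg.1) Cg.2).

(** A point x of the level set lies in a child of its kept box. Accuracy there bounds |g x - a| by
    the threshold, so x itself certifies that the child is kept. *)
Lemma level_set_sub_output i : level_set f a `<=` ba_output_set i.
Proof.
elim: i => [|i IH] x xa.
  exists (unit_box R d, cst a); first by rewrite inE.
  split; first by case: xa.
  by rewrite /cst subrr normr0 mulr_ge0// ?powR_ge0// ltW.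
have [Cg Cgi [Cgx _]] := IH x xa.
have [s Csx] := sub_box_cover Cgx.
have : sub_box Cg.1 s \in [seq Cg.1 | Cg <- ba_picked (run i.+1)].
  rewrite (perm_mem (ba_picked_boxes i)); apply/allpairsP.
  by exists (Cg.1, s); split=> //; [exact: (map_f _ Cgi) | rewrite mem_enum].
case/mapP => -[C g] Cgp /= CE; rewrite CE in Csx.
(* The child is identified as a dyadic box of level i+1, whose side turns accuracy into the
   threshold. *)
have := ba_picked_boxes i; have [zs [kE uzs zsi]] := ba_kept_dyadic i.
have [zs' [bE _ _]] := bisect_dyadic (R := R) uzs zsi.
rewrite kE bE => /perm_mem/(_ C).
rewrite (map_f (fun Cg : box R d * ('rV[R]_d -> R) => Cg.1) Cgp).
move=> /esym/mapP[z _ zC].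
have gx : `|g x - a| <= ba_threshold b beta i.+1.
  have [_ <-] := xa; rewrite zC in Csx.
  apply: accurate_dyadic_box hb hbeta _ Csx.
  by have := haccurate _ _ Cgp; rewrite zC.
exists (C, g) => //; rewrite ba_kept_picked mem_filter Cgp andbT.
by apply/asboolP; exists x.
Qed.

(** By the triangle inequality |f - a| <= |g - a| + |g - f|, with each term at most the threshold.
    The premise for i = 0 covers the approximator [cst a], which is set at the start rather than
    picked. *)
Lemma ba_kept_accurate {i Cg x} :
  (i = 0%N -> accurate b beta f (box_set (unit_box R d)) (cst a)) ->
  Cg \in ba_kept (run i) -> box_set Cg.1 x ->
  `|Cg.2 x - a| <= ba_threshold b beta i ->
  inflated_level_set f a (2 * ba_threshold b beta i) x.
Proof.
move=> acc0 Cgi Cgx gx.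
have [zs [kE uzs zsi]] := ba_kept_dyadic i.
have /mapP[z zzs Cz] : Cg.1 \in [seq dyadic_box i z | z <- zs].
  by rewrite -kE map_f.
split; first by rewrite Cz in Cgx; apply: dyadic_box_sub_unit Cgx; exact: zsi.
have acc : accurate b beta f (box_set Cg.1) Cg.2.
  case: i acc0 Cgi {gx kE zsi Cz} => [/(_ erefl) acc0|i _].
    by rewrite inE => /eqP ->.
  by rewrite ba_kept_picked mem_filter => /andP[_ /(haccurate i.+1)].
rewrite Cz in acc Cgx; have := accurate_dyadic_box hb hbeta acc Cgx.
have -> : f x - a = (Cg.2 x - a) - (Cg.2 x - f x) by ring.
move=> gf; apply: le_trans (ler_normB _ _) _; lra.
Qed.

Lemma ba_output_approx i eps :
  (i_eps b beta eps <= 0 ->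
     accurate b beta f (box_set (unit_box R d)) (cst a)) ->
  0 < eps -> i_eps b beta eps <= i%:Z ->
  eps_approximation f a eps (ba_output_set i).
Proof.
move=> hinit eps0 ii; split; first exact: level_set_sub_output.
move=> x [Cg Cgi [Cgx gx]].
have [|xu fx] := ba_kept_accurate _ Cgi Cgx gx.
  (* At i = 0, [ii] becomes the inequality that [hinit] asks for. *)
  by move=> i0; apply: hinit; rewrite i0 in ii.
split=> //; apply: le_trans fx _; rewrite /ba_threshold mulrA.
have ln2 : 0 < ln 2 :> R by rewrite ln_gt0// ltr1n.
have e0 : 0 < 2 * b / eps by rewrite !mulr_gt0// invr_gt0.
(* After taking logarithms this says that i is at least log2(2b/eps)/beta, which is [ii] without the
   ceiling. *)
have : 2 * b / eps <= 2 `^ (beta * i%:R).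
  rewrite -ler_ln ?posrE ?powR_gt0// ln_powR -ler_pdivrMr// -ler_pdivrMl//.
  by move: ii; rewrite /i_eps ceil_le_int.
by rewrite powRN !ler_pdivrMr ?powR_gt0// [eps * _]mulrC.
Qed.

(** Ensures that, for positive [k], every iteration makes queries. *)
Lemma ba_kept_gt0 i : level_set f a !=set0 -> (0 < size (ba_kept (run i)))%N.
Proof.
move=> [x /(level_set_sub_output i)[Cg]].
by case: (ba_kept (run i)).
Qed.

Lemma size_ba_kept i : level_set f a !=set0 ->
  ((size (ba_kept (run i)))%:R%:E <=
    (2 ^ d)%:R%:E * packing_limit f a b beta i)%E.
Proof.
move=> [x0 x0a]; have [zs [kE uzs zsi]] := ba_kept_dyadic i.
have -> : size (ba_kept (run i)) = size zs.
  by rewrite -(size_map (fun Cg => Cg.1)) kE size_map.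
apply: size_le_packing_limit => // z zzs.
rewrite -mulrA -/(ba_threshold b beta i).
have : (dyadic_box i z : box R d) \in [seq dyadic_box i z | z <- zs].
  exact: map_f.
rewrite -kE.
(* At level 0 the accuracy of [cst a] is not at hand, so the witness in the unit box is a point of
   the level set; at later levels the selection rule supplies one. *)
have [->|i0] := posnP i.
  rewrite inE => /eqP ->; have [x0u fx0] := x0a; exists x0 => //.
  by split=> //; rewrite fx0 subrr normr0 !mulr_ge0// ?powR_ge0// ltW.
case/mapP => Cg Cgi CgE.
have [x Cgx gx] : exists2 x,
    box_set Cg.1 x & `|Cg.2 x - a| <= ba_threshold b beta i.
  case: i i0 Cgi {kE zsi CgE} => // i _.
  by rewrite ba_kept_picked mem_filter => /andP[/asboolP].
exists x; last by rewrite CgE.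
by apply: ba_kept_accurate Cgi Cgx gx => ii; rewrite ii in i0.
Qed.

End Run.

(** * Query count and conclusion *)

Theorem theorem2 (R : realType) (d : nat) (hd : (1 <= d)%N)
    (alg : ba_algorithm R d) (a : R) (k : nat) (hk : (1 <= k)%N)
    (b beta : R) (hb : 0 < b) (hbeta : 0 < beta)
    (f : 'rV[R]_d -> R) (hf : level_set f a !=set0)
    (haccurate : forall (i : nat) (Cg : box R d * ('rV[R]_d -> R)),
       Cg \in ba_picked (ba_run alg f a k b beta i) ->
       accurate b beta f (box_set Cg.1) Cg.2)
    (eps : R) (heps : 0 < eps)
    (hinit : i_eps b beta eps <= 0 ->
       accurate b beta f (box_set (unit_box R d)) (cst a))
    (n : nat) (hn : (n_eps f a k b beta eps < (n%:R)%:E)%E) :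
  (exists S : set 'rV[R]_d, ba_output alg f a k b beta n S) /\
  (forall S : set 'rV[R]_d, ba_output alg f a k b beta n S ->
     eps_approximation f a eps S).
Proof.
set N := `|Num.max 0%R (i_eps b beta eps)|%N.
pose H i := size (ba_history (ba_run alg f a k b beta i)).
have HS i : H i.+1 =
    (H i + k * (2 ^ d * size (ba_kept (ba_run alg f a k b beta i))))%N.
  by rewrite /H !size_ba_history big_nat_recr.
have HN : (H N < n)%N.
  rewrite -(ltr_nat R) -lte_fin; apply: le_lt_trans hn.
  rewrite /n_eps -/N /H size_ba_history natr_sum -sumEFin ge0_sume_distrr.
    (* One factor 2^d counts the children of each kept box, the other the parity classes. *)
    apply: lee_sum => i _; have -> : (4 ^ d * k = k * 2 ^ d * 2 ^ d)%N.
      by rewrite -[4%N]/(2 * 2)%N expnMn mulnC mulnA.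
    rewrite mulnA !(natrM _ (k * 2 ^ d)) !EFinM -muleA lee_wpmul2l ?lee_fin//.
    exact: size_ba_kept.
  by move=> i _; exact: packing_limit_ge0.
have Hlt i : (H i < H i.+1)%N.
  by rewrite HS -[ltnLHS]addn0 ltn_add2l !muln_gt0 hk expn_gt0/= ba_kept_gt0.
have Hmono : {homo H : i j / (i <= j)%N}.
  by apply: homo_leq => // [? ? ?|i]; [exact: leq_trans | exact: ltnW].
have Hge i : (i <= H i)%N.
  by elim: i => // i IH; exact: leq_ltn_trans IH (Hlt i).
have n0 : (0 < n)%N by apply: leq_ltn_trans HN.
split.
  (* Each iteration makes at least one query, so n iterations reach the n-th one. *)
  have : onth (ba_history (ba_run alg f a k b beta n)) n.-1.
    by rewrite onthTE prednK//; exact: Hge.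
  case E: onth => [[[x y] S]|] // _.
  by exists S; split=> //; exists n, x, y.
move=> S [_ [i [x [y /ba_history_entry[j nj /= ->]]]]].
(* Log positions start at 0, so [nj] gives n <= H (j+1); if j < N, monotonicity would give n <= H N,
   against [HN]. *)
have Nj : (N <= j)%N.
  rewrite -ltnS ltnNge; apply/negP => /Hmono; rewrite leqNgt => /negP; apply.
  by apply: leq_trans HN _; rewrite -[leqLHS]prednK.
apply: ba_output_approx => //.
rewrite -lez_nat in Nj; apply: le_trans Nj.
by rewrite gez0_abs le_max lexx ?orbT.
Qed.
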